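(* For all $N$, the Okada monoid $\mathbf{O}_N$ is aperiodic.
   Context: The Okada monoid $\mathbf{O}_N$ is the monoid generated by $\mathsf{e}_1,\dots,\mathsf{e}_{N-1}$ with relations $\mathsf{e}_i^2=\mathsf{e}_i$ ($1\le i\le N-1$), $\mathsf{e}_i\mathsf{e}_j=\mathsf{e}_j\mathsf{e}_i$ ($|i-j|\ge 2$), $\mathsf{e}_{i+1}\mathsf{e}_i\mathsf{e}_{i+1}=\mathsf{e}_{i+1}$ ($1\le i\le N-2$). It is finite. A monoid $M$ is aperiodic if for each $x\in M$ there is an integer $n>0$ with $x^n=x^{n+1}$. *)

(* Defs.v *)
From HB Require Import structures.
From mathcomp Require Import all_boot.
From mathcomp Require Import boolp.

Set Implicit Arguments.
Unset Strict Implicit.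
Unset Printing Implicit Defensive.

Local Open Scope group_scope.
Local Open Scope quotient_scope.

Inductive pcongr (X : Type) (R : seq X -> seq X -> Prop) :
    seq X -> seq X -> Prop :=
| pcongr_rel u v : R u v -> pcongr R u v
| pcongr_refl u : pcongr R u u
| pcongr_sym u v : pcongr R u v -> pcongr R v u
| pcongr_trans u v w : pcongr R u v -> pcongr R v w -> pcongr R u w
| pcongr_cat u u' v v' :
    pcongr R u u' -> pcongr R v v' -> pcongr R (u ++ v) (u' ++ v').

(* Quotients in generic_quotient are taken by boolean relations, hence the
   (classical) reflection of the congruence. *)
Definition pcongrb (X : Type) (R : seq X -> seq X -> Prop) : rel (seq X) :=
  fun u v => `[< pcongr R u v >].

Lemma pcongrb_refl (X : Type) (R : seq X -> seq X -> Prop) :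
  reflexive (pcongrb R).
Proof. by move=> u; apply/asboolP; apply: pcongr_refl. Qed.

Lemma pcongrb_sym (X : Type) (R : seq X -> seq X -> Prop) :
  symmetric (pcongrb R).
Proof. by move=> u v; apply/asboolP/asboolP; apply: pcongr_sym. Qed.

Lemma pcongrb_trans (X : Type) (R : seq X -> seq X -> Prop) :
  transitive (pcongrb R).
Proof.
move=> v u w /asboolP uv /asboolP vw.
by apply/asboolP; apply: pcongr_trans uv vw.
Qed.

Canonical pcongrb_equiv (X : Type) (R : seq X -> seq X -> Prop) :=
  EquivRel (pcongrb R) (@pcongrb_refl X R) (@pcongrb_sym X R)
    (@pcongrb_trans X R).

(* The monoid < X | R >: the free monoid (seq X, ++) modulo the congruence
   generated by R. *)
Definition presented_monoid (X : choiceType) (R : seq X -> seq X -> Prop) :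
  Type := {eq_quot pcongrb R}.

HB.instance Definition _ (X : choiceType) (R : seq X -> seq X -> Prop) :=
  Choice.on (presented_monoid R).
HB.instance Definition _ (X : choiceType) (R : seq X -> seq X -> Prop) :=
  EqQuotient.on (presented_monoid R).

Lemma pmon_eqP (X : choiceType) (R : seq X -> seq X -> Prop) (u v : seq X) :
  u = v %[mod presented_monoid R] <-> pcongr R u v.
Proof.
split=> [/eqmodP /asboolP // | uv].
by apply/eqmodP/asboolP.
Qed.

Definition pmon_one (X : choiceType) (R : seq X -> seq X -> Prop) :
  presented_monoid R := \pi_(presented_monoid R) [::].
Definition pmon_mul (X : choiceType) (R : seq X -> seq X -> Prop)
  (x y : presented_monoid R) : presented_monoid R :=
  \pi_(presented_monoid R) (repr x ++ repr y).

Lemma pmon_mul_pi (X : choiceType) (R : seq X -> seq X -> Prop)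
    (u v : seq X) :
  pmon_mul (\pi_(presented_monoid R) u) (\pi_(presented_monoid R) v)
    = \pi_(presented_monoid R) (u ++ v).
Proof. by apply/pmon_eqP; apply: pcongr_cat; apply/pmon_eqP; rewrite reprK. Qed.

Lemma pmon_mulA (X : choiceType) (R : seq X -> seq X -> Prop) :
  associative (@pmon_mul X R).
Proof.
move=> x y z; rewrite -[x]reprK -[y]reprK -[z]reprK.
move: (repr x) (repr y) (repr z) => u v w.
by rewrite (pmon_mul_pi R v w) (pmon_mul_pi R u v) !pmon_mul_pi catA.
Qed.

Lemma pmon_mul1 (X : choiceType) (R : seq X -> seq X -> Prop) :
  left_id (pmon_one R) (@pmon_mul X R).
Proof. by move=> x; rewrite -[x]reprK pmon_mul_pi. Qed.

Lemma pmon_mulx1 (X : choiceType) (R : seq X -> seq X -> Prop) :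
  right_id (pmon_one R) (@pmon_mul X R).
Proof. by move=> x; rewrite -[x]reprK pmon_mul_pi cats0. Qed.

HB.instance Definition _ (X : choiceType) (R : seq X -> seq X -> Prop) :=
  isMonoid.Build (presented_monoid R) (@pmon_mulA X R) (@pmon_mul1 X R)
    (@pmon_mulx1 X R).

Definition pmon_gen (X : choiceType) (R : seq X -> seq X -> Prop) (a : X) :
  presented_monoid R := \pi_(presented_monoid R) [:: a].

Lemma pmon_pi_cat (X : choiceType) (R : seq X -> seq X -> Prop)
    (u v : seq X) :
  \pi_(presented_monoid R) (u ++ v)
    = \pi_(presented_monoid R) u * \pi_(presented_monoid R) v.
Proof. by rewrite -[RHS]/(pmon_mul _ _) pmon_mul_pi. Qed.

Lemma pmon_pi_prod (X : choiceType) (R : seq X -> seq X -> Prop)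
    (u : seq X) :
  \pi_(presented_monoid R) u = \prod_(a <- u) pmon_gen R a.
Proof.
elim: u => [|a u IHu]; first by rewrite big_nil.
by rewrite big_cons -IHu -cat1s pmon_pi_cat.
Qed.

(* The letter i : 'I_N.-1, counted from 0, stands for the generator
   e_(i + 1); there are no letters when N <= 1. *)
Inductive okada_rel (N : nat) : seq 'I_N.-1 -> seq 'I_N.-1 -> Prop :=
| okada_idem (i : 'I_N.-1) : okada_rel [:: i; i] [:: i]
| okada_comm (i j : 'I_N.-1) :
    (i.+2 <= j) || (j.+2 <= i) -> okada_rel [:: i; j] [:: j; i]
| okada_absorb (i j : 'I_N.-1) :
    j = i.+1 :> nat -> okada_rel [:: j; i; j] [:: j].

Definition okada_monoid (N : nat) : monoidType :=
  presented_monoid (@okada_rel N).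

Definition okada_gen (N : nat) (i : 'I_N.-1) : okada_monoid N :=
  pmon_gen (@okada_rel N) i.

Lemma okada_gen_idem (N : nat) (i : 'I_N.-1) :
  okada_gen i * okada_gen i = okada_gen i.
Proof.
rewrite /okada_gen /pmon_gen -pmon_pi_cat.
by apply/pmon_eqP/pcongr_rel/okada_idem.
Qed.

Lemma okada_gen_comm (N : nat) (i j : 'I_N.-1) :
  (i.+2 <= j) || (j.+2 <= i) ->
  okada_gen i * okada_gen j = okada_gen j * okada_gen i.
Proof.
move=> ij; rewrite /okada_gen /pmon_gen -!pmon_pi_cat.
by apply/pmon_eqP/pcongr_rel/okada_comm.
Qed.

Lemma okada_gen_absorb (N : nat) (i j : 'I_N.-1) :
  j = i.+1 :> nat -> okada_gen j * okada_gen i * okada_gen j = okada_gen j.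
Proof.
move=> ij; rewrite /okada_gen /pmon_gen -(pmon_pi_cat _ [:: j]) -pmon_pi_cat.
by apply/pmon_eqP; apply: pcongr_rel; apply: okada_absorb.
Qed.

Definition aperiodic (M : monoidType) : Prop :=
  forall x : M, exists n : nat, (0 < n)%N /\ x ^+ n = x ^+ n.+1.

(* Main.v *)
Require Import Defs.
From mathcomp Require Import all_boot.

(** The proof rests on the maximal letter of a word.  Let O(k) be the submonoid
    generated by the letters i < k, so that O(N.-1) is everything and every
    element of O(j.-1) commutes with e_j.  Two facts, proved together by
    induction on k, bring a word down to smaller letters.

    - [okada_normal_form]: an element of O(k.+1) lies in O(k) or is a * e_k * b
      with a and b in O(k), that is, the maximal letter is needed at most once.
    - [okada_sandwich]: if x is in O(j), then e_j * x * e_j = y * e_j for some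
      y in O(j.-1).  Indeed x contains e_(j-1) at most once.  If it does not
      contain it, x commutes with e_j; if x = a * e_(j-1) * b, then a and b
      commute with e_j and e_j * e_(j-1) * e_j collapses to e_j.

    For aperiodicity, take x = a * e_k * b in O(k.+1) and choose y in O(k.-1)
    with e_k * (b * a) * e_k = y * e_k.  Then x ^+ n.+1 = a * y ^+ n * e_k * b
    for all n, so an equality y ^+ n = y ^+ n.+1 gives the same equality for x
    with the exponents shifted by one, and induction on k concludes. *)

Set Implicit Arguments.
Unset Strict Implicit.
Unset Printing Implicit Defensive.

Local Open Scope group_scope.

Section OkadaBelow.

Variable N : nat.

Local Notation e := (@okada_gen N).

Definition okada_below (k : nat) (x : okada_monoid N) : Prop :=
  exists2 u : seq 'I_N.-1, all (fun i : 'I_N.-1 => i < k)%N u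
                         & x = \prod_(i <- u) e i.

Lemma okada_below1 k : okada_below k 1.
Proof. by exists [::]; rewrite ?big_nil. Qed.

Lemma okada_belowM k x y :
  okada_below k x -> okada_below k y -> okada_below k (x * y).
Proof.
by move=> [u ku ->] [v kv ->]; exists (u ++ v); rewrite ?all_cat ?ku ?big_cat.
Qed.

Lemma okada_below_gen k (i : 'I_N.-1) : (i < k)%N -> okada_below k (e i).
Proof. by move=> ik; exists [:: i]; rewrite /= ?ik ?big_seq1. Qed.

Lemma okada_belowW k l x : (k <= l)%N -> okada_below k x -> okada_below l x.
Proof.
move=> kl [u ku ->]; exists u => //.
by apply: sub_all ku => i ik; apply: leq_trans kl.
Qed.

Lemma okada_below_top x : okada_below N.-1 x.
Proof.
exists (repr x); first by apply/allP => i _.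
by rewrite -pmon_pi_prod reprK.
Qed.

Lemma okada_below0 x : okada_below 0 x -> x = 1.
Proof. by move=> [[|i u] // _ ->]; rewrite big_nil. Qed.

(** The truncated predecessor makes the bound right for j = 0 as well: no letter
    is below 0, so x is then 1. *)
Lemma okada_below_commute (j : 'I_N.-1) x :
  okada_below j.-1 x -> commute x (e j).
Proof.
move=> [u + ->]; elim: u => [_|i u IHu /= /andP[ij /IHu cu]].
  by rewrite /commute big_nil mul1g mulg1.
rewrite /commute big_cons -mulgA cu !mulgA; congr (_ * _).
by apply: okada_gen_comm; rewrite -ltn_predRL ij.
Qed.

Definition okada_once (k : nat) (x : okada_monoid N) : Prop :=
  exists (j : 'I_N.-1) a b,
    [/\ j = k :> nat, okada_below k a, okada_below k b & x = a * e j * b].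

Definition okada_sandwiched (j : 'I_N.-1) (x : okada_monoid N) : Prop :=
  exists2 y, okada_below j.-1 y & e j * x * e j = y * e j.

(** Reading a word from the right, each further occurrence of the maximal letter
    meets at most one other, and the sandwich property merges the two. *)
Lemma okada_normal_form_of k x :
    (forall (j : 'I_N.-1) z,
      j = k :> nat -> okada_below k z -> okada_sandwiched j z) ->
  okada_below k.+1 x -> okada_below k x \/ okada_once k x.
Proof.
move=> sandwich [u + ->].
elim: u => [_|i u IHu /= /andP[ik1 /IHu {}IHu]].
  by left; rewrite big_nil; apply: okada_below1.
rewrite big_cons; move: (\prod_(j <- u) e j) IHu => x' IHx'.
move: ik1; rewrite ltnS leq_eqVlt => /orP[/eqP ik | ik]; last first.
  have ei := okada_below_gen ik.
  case: IHx' => [xk | [j [a [b [jk ak bk ->]]]]].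
    by left; apply: okada_belowM.
  right; exists j, (e i * a), b; split=> //; first exact: okada_belowM.
  by rewrite !mulgA.
right; case: IHx' => [xk | [j [a [b [jk ak bk ->]]]]].
  by exists i, 1, x'; split=> //; [apply: okada_below1 | rewrite mul1g].
have <- : i = j by apply: val_inj; rewrite /= ik jk.
have [y yk eay] := sandwich i a ik ak.
exists i, y, b; split=> //; last by rewrite !mulgA eay.
by apply: okada_belowW yk; rewrite ik leq_pred.
Qed.

(** Two occurrences of e_j surround at most one e_(j-1).  If there is none, the
    inner factor commutes with e_j; otherwise e_(j-1) can be brought next to
    both of them, which absorb it. *)
Lemma okada_sandwich (j : 'I_N.-1) x : okada_below j x -> okada_sandwiched j x.
Proof.
have [k jk] : exists k, j = k :> nat by exists j.
rewrite jk; elim: k => [|k IHk] in j x jk *.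
  move=> /okada_below0 ->; exists 1; first exact: okada_below1.
  by rewrite mulg1 mul1g okada_gen_idem.
rewrite /okada_sandwiched => xk.
have jk' : j.-1 = k by rewrite jk.
have comm z : okada_below k z -> e j * z = z * e j.
  by rewrite -jk' => /okada_below_commute <-.
rewrite jk'; case: (okada_normal_form_of _ xk) => [i z ik zk | {}xk |].
- by apply: (IHk i z ik).
- by exists x; rewrite // comm // -mulgA okada_gen_idem.
case=> i [a [b [ik ak bk ->]]]; exists (a * b); first exact: okada_belowM.
rewrite !mulgA comm // -!mulgA; congr (_ * _).
by rewrite -comm // !mulgA okada_gen_absorb // jk ik.
Qed.

Lemma okada_normal_form k x :
  okada_below k.+1 x -> okada_below k x \/ okada_once k x.
Proof.
by apply: okada_normal_form_of => j z <-; apply: okada_sandwich.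
Qed.

(** The powers of a * e_j * b contain e_j * (b * a) * e_j between consecutive
    factors, and each of these sandwiches contributes one y. *)
Lemma okada_once_expgS (j : 'I_N.-1) a b y n :
    e j * (b * a) * e j = y * e j ->
  (a * e j * b) ^+ n.+1 = a * y ^+ n * e j * b.
Proof.
move=> eay; elim: n => [|n IHn]; first by rewrite mulg1.
rewrite expgSr IHn !mulgA; congr (_ * b).
rewrite -!mulgA; congr (a * _); rewrite expgSr -mulgA; congr (_ * _).
by rewrite -eay !mulgA.
Qed.

Lemma okada_below_aperiodic k x :
  okada_below k x -> exists n : nat, (0 < n)%N /\ x ^+ n = x ^+ n.+1.
Proof.
elim/ltn_ind: k x => -[_ x /okada_below0 -> | k IHk x].
  by exists 1%N; rewrite !expg1n.
case/okada_normal_form => [xk | [j [a [b [jk ak bk ->]]]]]; first exact: IHk xk.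
have bak : okada_below j (b * a) by rewrite jk; apply: okada_belowM.
have [y yj eay] := okada_sandwich bak.
have [|n [_ yn]] := IHk j.-1 _ y yj; first by rewrite jk ltnS leq_pred.
by exists n.+1; rewrite !(okada_once_expgS _ eay) yn.
Qed.

End OkadaBelow.

Theorem theorem5p13 (N : nat) : aperiodic (okada_monoid N).
Proof. by move=> x; apply: okada_below_aperiodic (okada_below_top x). Qed.
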